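(* Let $\mu$ be a finite measure on the Borel $\sigma$-field $\mathcal{B}([0,1])$ and let $f,g_1,\dots,g_n\in L_2(\mu)$ satisfy: 1. $f:[0,1]\to[0,\infty)$ is non-decreasing. 2. Each $g_i:[0,1]\to\mathbb{R}$ is of decreasing block structure with respect to $0$ and fulfills $\int_{[0,1]}g_i\,d\mu=0$. 3. Whenever $i\ne j$, $g_i(x)g_j(x)=0$ for every $x\in[0,1]$. Then for $g=\sum_{i=1}^n g_i$, $$\Vert f-g\Vert_2^2\ \ge\ \Vert f\Vert_2^2+\Vert g\Vert_2^2 .$$
   Context: $\Vert\cdot\Vert_2$ is the $L_2(\mu)$-norm. A function $g:[0,1]\to\mathbb{R}$ is of decreasing block structure with respect to $0$ if there exists $x_0\in[0,1]$ such that one of the following holds: (B1) $g(x)\ge0$ for every $x\in[0,x_0)$ and $g(x)\le0$ for every $x\in[x_0,1]$; (B2) $g(x)\ge0$ for every $x\in[0,x_0]$ and $g(x)\le0$ for every $x\in(x_0,1]$. *)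

(* Defs.v *)
From HB Require Import structures.
From mathcomp Require Import all_boot all_order all_algebra.
From mathcomp Require Import all_classical all_reals all_analysis.
Import Order.TTheory GRing.Theory Num.Theory numFieldNormedType.Exports.

Set Implicit Arguments.
Unset Strict Implicit.
Unset Printing Implicit Defensive.

Local Open Scope classical_set_scope.
Local Open Scope ring_scope.

Definition unit_itv (R : realType) : Type := `[0 : R, 1 : R]%classic.

HB.instance Definition _ (R : realType) :=
  Topological.copy (unit_itv R) (set_type `[0 : R, 1 : R]%classic).

Lemma unit_itv0_proof (R : realType) : (0 : R) \in `[0 : R, 1 : R]%classic.
Proof. by rewrite inE /= in_itv /= lexx ler01. Qed.

(* `measurableType`s are required to be pointed; the choice of point is
   irrelevant. *)
HB.instance Definition _ (R : realType) :=
  isPointed.Build (unit_itv R) (exist _ 0 (unit_itv0_proof R)).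

Definition itv_val (R : realType) (x : unit_itv R) : R := set_val x.

(* [0, 1] with the Borel sigma-field of the topology induced from R. *)
Notation borel_unit_itv R := (g_sigma_algebraType (@open (unit_itv R))).

Section block_structure.
Context {R : realType}.
Implicit Type g : unit_itv R -> R.

Definition block_B1 g (x0 : unit_itv R) :=
  (forall x, itv_val x < itv_val x0 -> 0 <= g x) /\
  (forall x, itv_val x0 <= itv_val x -> g x <= 0).

Definition block_B2 g (x0 : unit_itv R) :=
  (forall x, itv_val x <= itv_val x0 -> 0 <= g x) /\
  (forall x, itv_val x0 < itv_val x -> g x <= 0).

Definition decreasing_block_structure0 g :=
  exists x0 : unit_itv R, block_B1 g x0 \/ block_B2 g x0.

End block_structure.

(* Main.v *)
Require Import Defs.
From mathcomp Require Import all_boot all_order all_algebra.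
From mathcomp Require Import all_classical all_reals all_analysis.
From mathcomp Require Import ring.
Import Order.TTheory GRing.Theory Num.Theory.
Local Open Scope classical_set_scope.
Local Open Scope ring_scope.

(** Expanding the square, the claim says that the integral of [f * gsum] is at
    most 0, and by linearity it is enough to show this for each product
    [f * g i].  A function of decreasing block structure changes sign once,
    from nonnegative to nonpositive, at some threshold [x0], whereas
    [f - f x0] changes sign there the other way, [f] being nondecreasing.  So
    [(f - f x0) * g i <= 0] everywhere, that is, [f * g i <= f x0 * g i]; the
    right-hand side is a constant multiple of [g i] and integrates to 0
    (lemma [integral_nondecreasing_block_le0]).  The passage from the sign of
    the scalar product to the norms is [sqr_Lnorm2B_ge]. *)

Section L2.
Context d (T : measurableType d) (R : realType).
Variable mu : {measure set T -> \bar R}.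
Implicit Types f h : T -> R.

Lemma sqr_Lnorm2 f :
  ('N[mu]_(2%:E)[EFin \o f] ^+ 2 = \int[mu]_x (f x ^+ 2)%:E)%E.
Proof.
have poweR2 (y : \bar R) : (0 <= y)%E -> (y `^ 2 = y ^+ 2)%E.
  case: y => [y||] // y0; first by rewrite poweR_EFin powR_mulrn// -EFin_expe.
  by rewrite poweRyr ?pnatr_eq0// expe2 mulyy.
rewrite -poweR2 ?Lnorm_ge0// poweR_Lnorm ?pnatr_eq0//.
apply: eq_integral => x _.
by rewrite poweR2// -EFin_expe /= real_normK// num_real.
Qed.

Lemma Lfun2_integrableM f h : f \in Lfun mu 2%:E -> h \in Lfun mu 2%:E ->
  mu.-integrable [set: T] (fun x => (f x * h x)%:E).
Proof. by move=> f2 h2; apply/Lfun1_integrable/Lfun2_mul_Lfun1. Qed.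

(** The cross term of the expanded square is minus twice the scalar product. *)
Lemma sqr_Lnorm2B_ge f h : f \in Lfun mu 2%:E -> h \in Lfun mu 2%:E ->
  (\int[mu]_x (f x * h x)%:E <= 0)%E ->
  ('N[mu]_(2%:E)[EFin \o f] ^+ 2 + 'N[mu]_(2%:E)[EFin \o h] ^+ 2 <=
   'N[mu]_(2%:E)[EFin \o (f \- h)%R] ^+ 2)%E.
Proof.
move=> f2 h2 fh_le0; rewrite !sqr_Lnorm2.
have if2 := Lfun2_integrable_sqr f2.
have ih2 := Lfun2_integrable_sqr h2.
have ifh := Lfun2_integrableM _ _ f2 h2.
have ifh2 := integrableZl measurableT (-2) ifh.
have -> : (\int[mu]_x ((f \- h) x ^+ 2)%:E =
    \int[mu]_x ((f x ^+ 2)%:E + (h x ^+ 2)%:E + (-2)%:E * (f x * h x)%:E))%E.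
  by apply: eq_integral => x _; congr EFin => /=; ring.
rewrite integralD//=; last exact: integrableD.
rewrite integralD//= integralZl//.
by apply: leeDl; rewrite EFinN mulNe oppe_ge0 mule_ge0_le0.
Qed.

End L2.

Section block.
Context {R : realType}.

(** The constant is the value of [f] at the threshold of [g].  The kinds (B1)
    and (B2) differ only at the threshold, where the inequality is an equality
    whatever the sign of [g]. *)
Lemma nondecreasing_block_leM (f g : unit_itv R -> R) :
  (forall x y, itv_val x <= itv_val y -> f x <= f y) ->
  decreasing_block_structure0 g ->
  exists c, forall x, f x * g x <= c * g x.
Proof.
move=> fnd [x0 g_x0]; exists (f x0) => x.
have [xx0|x0x|xx0] := ltgtP (itv_val x) (itv_val x0).
- have g0 : 0 <= g x by case: g_x0 => -[g0 _]; apply: g0 => //; exact: ltW.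
  by rewrite ler_wpM2r// fnd// ltW.
- have g0 : g x <= 0 by case: g_x0 => -[_ g0]; apply: g0 => //; exact: ltW.
  by rewrite ler_wnM2r// fnd// ltW.
- by have -> : f x = f x0 by apply/eqP; rewrite eq_le !fnd// xx0.
Qed.

Lemma integral_nondecreasing_block_le0
  (mu : {finite_measure set (borel_unit_itv R) -> \bar R})
  (f g : borel_unit_itv R -> R) :
  f \in Lfun mu 2%:E -> g \in Lfun mu 2%:E ->
  (forall x y, itv_val x <= itv_val y -> f x <= f y) ->
  decreasing_block_structure0 g ->
  (\int[mu]_x (g x)%:E = 0)%E ->
  (\int[mu]_x (f x * g x)%:E <= 0)%E.
Proof.
move=> f2 g2 fnd gblock g0.
have [c fgc] := nondecreasing_block_leM _ _ fnd gblock.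
have ig : mu.-integrable setT (EFin \o g).
  by apply/Lfun1_integrable; apply: Lfun_subset12 => //; exact: fin_num_measure.
apply: (@le_trans _ _ (\int[mu]_x (c%:E * (g x)%:E))%E).
  apply: le_integral => //; [exact: Lfun2_integrableM|exact: integrableZl|].
  by move=> x _; rewrite -EFinM lee_fin.
by rewrite integralZl// g0 mule0.
Qed.

End block.

Theorem theorem4p4 (R : realType)
  (mu : {finite_measure set (borel_unit_itv R) -> \bar R})
  (n : nat) (f : borel_unit_itv R -> R) (g : 'I_n -> borel_unit_itv R -> R)
  (f_L2 : f \in Lfun mu 2%:E)
  (g_L2 : forall i, g i \in Lfun mu 2%:E)
  (f_ge0 : forall x, 0 <= f x)
  (f_nondecreasing : forall x y, itv_val x <= itv_val y -> f x <= f y)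
  (g_block : forall i, decreasing_block_structure0 (g i))
  (g_int0 : forall i, (\int[mu]_x (g i x)%:E = 0)%E)
  (g_disjoint : forall i j, i != j -> forall x, g i x * g j x = 0) :
  let gsum := fun x => \sum_(i < n) g i x in
  ('N[mu]_(2%:E)[EFin \o (f \- gsum)%R] ^+ 2
   >= 'N[mu]_(2%:E)[EFin \o f] ^+ 2 + 'N[mu]_(2%:E)[EFin \o gsum] ^+ 2)%E.
Proof.
cbv zeta; set gsum := fun x => \sum_(i < n) g i x.
have gsum_L2 : gsum \in Lfun mu 2%:E.
  have -> : gsum = \sum_(i < n) g i by apply/funext => x; rewrite fct_sumE.
  have [L0 LD] : addr_closed (Lfun mu 2%:E).
    by apply: Lfun_addr_closed; rewrite lee1n.
  by elim/big_ind: _.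
apply: sqr_Lnorm2B_ge => //.
under eq_integral do rewrite mulr_sumr -sumEFin.
rewrite integral_sum//; last by move=> i; exact: Lfun2_integrableM.
by apply: sume_le0 => i _; exact: integral_nondecreasing_block_le0.
Qed.
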